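(* Let $h:(X_2,R_2)\to(X_1,R_1)$ be a continuous, surjective tournament map of compact topological tournaments. If $y\in X_1$ is a cycle point for $R_1$, then $h^{-1}(y)$ is a singleton $\{x\}$ and $x\in X_2$ is a cycle point for $R_2$. If every point of $X_1$ is a cycle point for $R_1$, then $h$ is a homeomorphism mapping $R_2$ isomorphically onto $R_1$.
   Context: All spaces are Hausdorff. A tournament on a nonempty set $X$ is a relation $R\subset X\times X$ with $R\cap R^{-1}=1_X=\{(x,x):x\in X\}$ and $R\cup R^{-1}=X\times X$; $R^\circ=R\setminus1_X$. $(X,R)$ is a compact topological tournament when $X$ is compact and $R$ is closed in $X\times X$. A tournament map $h:(X_2,R_2)\to(X_1,R_1)$ is a function $h:X_2\to X_1$ with $(h\times h)(R_2)\subset R_1$. A 3-cycle is a triple of distinct points with $(x_1,x_2),(x_2,x_3),(x_3,x_1)\in R^\circ$. A point $x$ is a cycle point when every open set containing $x$ contains a 3-cycle which includes $x$. *)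

(* Defs.v *)
From mathcomp Require Import all_boot all_algebra.
From mathcomp Require Import all_classical topology.

Set Implicit Arguments.
Unset Strict Implicit.
Unset Printing Implicit Defensive.

Local Open Scope classical_set_scope.

Section Tournament.
Context {X : Type}.
Implicit Types R : set (X * X).

(* [diagonal] is the identity relation and [R^-1%relation] the converse of R;
   tournaments are reflexive and live on nonempty sets. *)
Definition tournament R : Prop :=
  [/\ [set: X] !=set0,
      R `&` R^-1%relation = diagonal &
      R `|` R^-1%relation = [set: X * X]].

Definition strict R : set (X * X) := R `\` diagonal.

Definition three_cycle R (x1 x2 x3 : X) : Prop :=
  [/\ x1 <> x2, x2 <> x3 & x3 <> x1] /\
  [/\ strict R (x1, x2), strict R (x2, x3) & strict R (x3, x1)].

End Tournament.

Definition map_pair {X Y : Type} (h : X -> Y) (z : X * X) : Y * Y :=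
  (h z.1, h z.2).

Definition tournament_map {X2 X1 : Type}
    (R2 : set (X2 * X2)) (R1 : set (X1 * X1)) (h : X2 -> X1) : Prop :=
  map_pair h @` R2 `<=` R1.

Definition tournament_isomorphism {X2 X1 : Type}
    (R2 : set (X2 * X2)) (R1 : set (X1 * X1)) (h : X2 -> X1) : Prop :=
  bijective h /\ map_pair h @` R2 = R1.

Definition compact_topological_tournament {X : topologicalType}
    (R : set (X * X)) : Prop :=
  [/\ hausdorff_space X, compact [set: X], tournament R & closed R].

Definition cycle_point {X : topologicalType} (R : set (X * X)) (x : X) : Prop :=
  forall U : set X, open U -> U x ->
    exists x1 x2 x3 : X,
      [/\ three_cycle R x1 x2 x3,
          [set x1; x2; x3] `<=` U &
          [set x1; x2; x3] x].

Definition homeomorphism {X Y : topologicalType} (h : X -> Y) : Prop :=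
  continuous h /\
  exists g : Y -> X, [/\ cancel h g, cancel g h & continuous g].

(* Main.v *)
Require Import Defs.
From mathcomp Require Import all_boot all_algebra.
From mathcomp Require Import all_classical topology.

Local Open Scope classical_set_scope.

(** A tournament map reflects strict arcs: if [h x] and [h x'] are distinct
and [h x -> h x'], then [x -> x'], because the only other arc, [x' -> x], would be
pushed forward to [h x' -> h x].  Consequently, if [y] lies on
a 3-cycle [y -> a -> b -> y] of the target, any lifts [a'], [b'] of [a], [b]
satisfy [z -> a' -> b' -> z] simultaneously for every [z] in the fiber of [y].
When [y] is a cycle point, such pairs [(a, b)] exist arbitrarily close to
[(y, y)], and the relation just described is closed, so by compactness it also
holds for some [a'], [b'] lying in the fiber itself
([cycle_point_fiber_limit]).  Taking [z = a'] gives [b' -> a'], hence [a' = b'];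
then [z -> a' -> z] for every [z] in the fiber, so the fiber is the point [a'].

The map is closed, being continuous from a compact space to a Hausdorff one, so
a neighborhood of the single point over [y] contains the preimage of a
neighborhood of [y] ([fiber_tube]).  A 3-cycle through [y] in the latter lifts
to a 3-cycle through the point over [y] in the former.  If every point of the
target is a cycle point, [h] is thus a closed continuous bijection, and it
carries arcs onto arcs since any two points of the source are joined by an arc. *)

(** * Topological preliminaries *)

Lemma hausdorff_prod (X Y : topologicalType) :
  hausdorff_space X -> hausdorff_space Y -> hausdorff_space (X * Y)%type.
Proof.
move=> hX hY [x y] [x' y'] cl; congr pair.
- apply: hX => A B nA nB.
  have [||[u v] [/= Au Bu]] := cl (A `*` setT) (B `*` setT).
  + by exists (A, setT) => //; split => //; exact: filterT.
  + by exists (B, setT) => //; split => //; exact: filterT.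
  by exists u; split; [case: Au | case: Bu].
- apply: hY => A B nA nB.
  have [||[u v] [/= Au Bu]] := cl (setT `*` A) (setT `*` B).
  + by exists (setT, A) => //; split => //; exact: filterT.
  + by exists (setT, B) => //; split => //; exact: filterT.
  by exists v; split; [case: Au | case: Bu].
Qed.

Lemma compact_hausdorff_closed_map (X Y : topologicalType) (f : X -> Y) :
  compact [set: X] -> hausdorff_space Y -> continuous f ->
  forall A, closed A -> closed (f @` A).
Proof.
move=> cX hY cf A clA; apply: compact_closed => //.
apply: continuous_compact; first exact: continuous_subspaceT.
exact: subclosed_compact clA cX _.
Qed.

Lemma fiber_tube (X Y : topologicalType) (f : X -> Y) (y : Y) (U : set X) :
  (forall A, closed A -> closed (f @` A)) -> open U -> f @^-1` [set y] `<=` U ->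
  exists V, [/\ open V, V y & f @^-1` V `<=` U].
Proof.
move=> clf oU fU; exists (~` (f @` (~` U))); split.
- by apply: closed_openC; apply: clf; exact: open_closedC.
- by case=> x Ux /fU.
- by move=> x /= nx; apply: contrapT => Ux; apply: nx; exists x.
Qed.

Lemma map_pair_continuous (X Y : topologicalType) (f : X -> Y) :
  continuous f -> continuous (map_pair f).
Proof.
move=> cf [x x']; apply: cvg_pair => /=.
  by apply: (@cvg_comp _ _ _ fst f _ (nbhs x)); [exact: cvg_fst | exact: cf].
by apply: (@cvg_comp _ _ _ snd f _ (nbhs x')); [exact: cvg_snd | exact: cf].
Qed.

(** * Tournaments and their maps *)

Section TournamentFacts.
Context {X : Type} (R : set (X * X)).
Hypothesis tR : tournament R.

Lemma tournament_anti x x' : R (x, x') -> R (x', x) -> x = x'.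
Proof.
case: tR => _ Ranti _ xx' x'x.
have : (R `&` R^-1%relation) (x, x') by [].
by rewrite Ranti.
Qed.

Lemma tournament_total x x' : R (x, x') \/ R (x', x).
Proof.
case: tR => _ _ Rtot.
have : [set: X * X] (x, x') by [].
by rewrite -Rtot.
Qed.

End TournamentFacts.

Section TournamentMap.
Context {X2 X1 : Type} (R2 : set (X2 * X2)) (R1 : set (X1 * X1)) (h : X2 -> X1).
Hypotheses (tR2 : tournament R2) (tR1 : tournament R1).
Hypothesis h_map : tournament_map R2 R1 h.

Lemma tournament_map_arc x x' : R2 (x, x') -> R1 (h x, h x').
Proof. by move=> xx'; apply: h_map; exists (x, x'). Qed.

Lemma tournament_map_lift_arc x x' :
  strict R1 (h x, h x') -> strict R2 (x, x').
Proof.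
move=> [hxx' hne].
have xne : ~ diagonal (x, x').
  by rewrite /diagonal /= => xx'; apply: hne; rewrite /diagonal /= xx'.
have [//|/tournament_map_arc hx'x] := tournament_total R2 tR2 x x'.
by case: hne; exact: (tournament_anti R1 tR1).
Qed.

Lemma tournament_map_lift_three_cycle x1 x2 x3 :
  three_cycle R1 (h x1) (h x2) (h x3) -> three_cycle R2 x1 x2 x3.
Proof.
move=> [[n12 n23 n31] [a12 a23 a31]]; split; last first.
  by split; exact: tournament_map_lift_arc.
by split=> e; [case: n12|case: n23|case: n31]; rewrite e.
Qed.

Lemma bijective_tournament_map_isomorphism :
  bijective h -> tournament_isomorphism R2 R1 h.
Proof.
move=> bh; split=> //; apply/seteqP; split=> //.
case: (bh) => g gK hK [y y'] yy'.
exists (g y, g y'); last by rewrite /map_pair /= !hK.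
have [//|g'g] := tournament_total R2 tR2 (g y) (g y').
have := tournament_map_arc _ _ g'g; rewrite !hK => y'y.
by move: g'g; rewrite (tournament_anti R1 tR1 _ _ yy' y'y).
Qed.

End TournamentMap.

Lemma three_cycle_rot {X : Type} (R : set (X * X)) x1 x2 x3 :
  three_cycle R x1 x2 x3 -> three_cycle R x2 x3 x1.
Proof. by move=> [[? ? ?] [? ? ?]]; do 2!split. Qed.

(** A 3-cycle is invariant under rotation, so a cycle point may be taken as its
first vertex. *)
Lemma cycle_point_first {X : topologicalType} (R : set (X * X)) (x : X) :
  cycle_point R x <->
  forall U, open U -> U x -> exists a b, [/\ three_cycle R x a b, U a & U b].
Proof.
split=> cx U oU Ux.
- have [x1 [x2 [x3 [c sU]]]] := cx U oU Ux.
  have [U1 U2 U3] : [/\ U x1, U x2 & U x3].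
    by split; apply: sU; [left; left | left; right | right].
  move=> [[] ->|->].
  + by exists x2, x3.
  + by exists x3, x1; split=> //; exact: three_cycle_rot.
  + by exists x1, x2; split=> //; do 2!apply: three_cycle_rot.
- have [a [b [c Ua Ub]]] := cx U oU Ux.
  exists x, a, b; split=> //; last by left; left.
  by move=> z [[] ->|->].
Qed.

(** * Maps of compact topological tournaments *)

Section CompactTournamentMap.
Context {X2 X1 : topologicalType}.
Context {R2 : set (X2 * X2)} {R1 : set (X1 * X1)} {h : X2 -> X1}.
Hypotheses (hR2 : compact_topological_tournament R2).
Hypotheses (hR1 : compact_topological_tournament R1).
Hypotheses (h_cont : continuous h) (h_surj : set_surj [set: X2] [set: X1] h).
Hypothesis h_map : tournament_map R2 R1 h.

(** Pairs that close up to a 3-cycle with every point of the fiber over [y] at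
once; the strictness of the arcs is dropped to make the condition closed. *)
Let cycle_over (y : X1) : set (X2 * X2) :=
  [set p | R2 p /\ forall z, h z = y -> R2 (z, p.1) /\ R2 (p.2, z)].

Lemma closed_cycle_over y : closed (cycle_over y).
Proof.
have [_ _ _ clR2] := hR2.
have -> : cycle_over y = R2 `&` \bigcap_(z in h @^-1` [set y])
    ((fun p => (z, p.1)) @^-1` R2 `&` (fun p => (p.2, z)) @^-1` R2).
  by [].
apply: closedI => //; apply: closed_bigI => z _; apply: closedI.
- apply: preimage_closed => // -[a b] _.
  by apply: cvg_pair; [exact: cvg_cst | exact: cvg_fst].
- apply: preimage_closed => // -[a b] _.
  by apply: cvg_pair; [exact: cvg_snd | exact: cvg_cst].
Qed.

(** The image of the closed set of pairs under [h] times [h] is closed by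
compactness, and the 3-cycles near [y] make [(y, y)] adherent to it. *)
Lemma cycle_point_fiber_limit y : cycle_point R1 y ->
  exists a b, [/\ h a = y, h b = y & cycle_over y (a, b)].
Proof.
have [_ cX2 tR2 _] := hR2; have [hX1 _ tR1 _] := hR1.
move=> /cycle_point_first cy.
have clC : closed (map_pair h @` cycle_over y).
  apply: compact_hausdorff_closed_map (closed_cycle_over y).
  - by rewrite -setXTT; exact: compact_setX.
  - exact: hausdorff_prod.
  - exact: map_pair_continuous.
suff [[a b] Cab [ha hb]] : (map_pair h @` cycle_over y) (y, y) by exists a, b.
apply: clC => W [[V V'] /= [nV nV'] VW].
have nVV' : nbhs y (V `&` V') by exact: filterI.
move: nVV'; rewrite nbhsE => -[U [oU Uy] UVV'].
have [a [b [[_ [ya ab by_]] Ua Ub]]] := cy U oU Uy.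
have [a' _ ha'] := h_surj a I; have [b' _ hb'] := h_surj b I.
exists (a, b); split; last first.
  by apply: VW; split; [case: (UVV' a Ua) | case: (UVV' b Ub)].
have lift := tournament_map_lift_arc R2 R1 h tR2 tR1 h_map.
exists (a', b'); last by rewrite /map_pair /= ha' hb'.
split; first by case: (lift a' b'); rewrite ?ha' ?hb'.
move=> z hz; split.
- by case: (lift z a'); rewrite ?hz ?ha'.
- by case: (lift b' z); rewrite ?hz ?hb'.
Qed.

Lemma cycle_point_fiber_singleton y : cycle_point R1 y ->
  exists x, h @^-1` [set y] = [set x].
Proof.
have [_ _ tR2 _] := hR2.
move=> /cycle_point_fiber_limit[a [b [ha hb [/= ab C]]]].
have {hb} eab : a = b by have [_ ba] := C a ha; exact: (tournament_anti R2).
rewrite -{b}eab in C ab *.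
exists a; apply/seteqP; split=> z /=; last by move=> ->.
by move=> /C[za az]; exact: (tournament_anti R2).
Qed.

Lemma compact_tournament_map_closed A : closed A -> closed (h @` A).
Proof.
have [_ cX2 _ _] := hR2; have [hX1 _ _ _] := hR1.
exact: compact_hausdorff_closed_map.
Qed.

Lemma cycle_point_lift x : cycle_point R1 (h x) ->
  h @^-1` [set h x] = [set x] -> cycle_point R2 x.
Proof.
have [_ _ tR2 _] := hR2; have [_ _ tR1 _] := hR1.
move=> /cycle_point_first cy fx; apply/cycle_point_first => U oU Ux.
have [|V [oV Vy VU]] := fiber_tube _ _ h (h x) U compact_tournament_map_closed oU.
  by rewrite fx => z ->.
have [a [b [cab Va Vb]]] := cy V oV Vy.
have [a' _ ha'] := h_surj a I; have [b' _ hb'] := h_surj b I.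
exists a', b'; split; last 2 first.
- by apply: VU; rewrite /= ha'.
- by apply: VU; rewrite /= hb'.
apply: (tournament_map_lift_three_cycle R2 R1 h) => //.
by rewrite ha' hb'.
Qed.

End CompactTournamentMap.

Theorem theorem7p6 (X2 X1 : topologicalType)
    (R2 : set (X2 * X2)) (R1 : set (X1 * X1)) (h : X2 -> X1)
    (hR2 : compact_topological_tournament R2)
    (hR1 : compact_topological_tournament R1)
    (h_cont : continuous h)
    (h_surj : set_surj [set: X2] [set: X1] h)
    (h_map : tournament_map R2 R1 h) :
  (forall y : X1, cycle_point R1 y ->
     exists x : X2, h @^-1` [set y] = [set x] /\ cycle_point R2 x) /\
  ((forall y : X1, cycle_point R1 y) ->
     homeomorphism h /\ tournament_isomorphism R2 R1 h).
Proof.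
have sing y := cycle_point_fiber_singleton hR2 hR1 h_cont h_surj h_map y.
split=> [y cy|cX1].
  have [x fx] := sing y cy.
  have hx : h x = y by have : [set x] x by []; rewrite -fx.
  exists x; split=> //; rewrite -hx in cy fx.
  exact: cycle_point_lift hR2 hR1 h_cont h_surj h_map x cy fx.
have /choice[g gP] y := sing y (cX1 y).
have hK : cancel g h.
  by move=> y; have : [set g y] (g y) by []; rewrite -gP.
have gK : cancel h g.
  move=> x; have : (h @^-1` [set h x]) x by [].
  by rewrite gP => /= {2}->.
split; last first.
  have [_ _ tR2 _] := hR2; have [_ _ tR1 _] := hR1.
  by apply: bijective_tournament_map_isomorphism => //; exists g.
split=> //; exists g; split=> //.
apply/continuous_closedP => A clA.
have -> : g @^-1` A = h @` A.
  apply/seteqP; split=> y /=; first by move=> Agy; exists (g y).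
  by move=> [x Ax <-]; rewrite gK.
exact: compact_tournament_map_closed hR2 hR1 h_cont _ clA.
Qed.
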